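(* Let $X$ be a Tychonoff space such that $X^n$ is pseudocompact for every $n\in\mathbb N$, and let $Y$ be a pseudocompact subspace of $P(\beta X)$ containing $P_f(X)$. Then $Y$ is $C^*$-embedded in $P(\beta X)$ (i.e., $\beta Y=P(\beta X)$).
   Context: All spaces are Tychonoff; $\beta X$ is the Stone–Čech compactification of $X$. For a space $Z$, $P(Z)$ is the set of Radon probability measures on the Borel $\sigma$-algebra of $Z$ (for every Borel $B$ and $\varepsilon>0$ there is a compact $K\subset B$ with $\mu(B\setminus K)<\varepsilon$), with the weak topology, i.e. the topology generated by the functions $\mu\mapsto\int_Z f\,d\mu$ for bounded continuous $f:Z\to\mathbb R$. $P_f(X)\subset P(\beta X)$ is the set of probability measures with finite support contained in $X$, i.e. finite convex combinations of Dirac measures $\delta_x$, $x\in X$. A space is pseudocompact if every continuous real-valued function on it is bounded. A subspace $Y\subset Z$ is $C^*$-embedded in $Z$ if every bounded continuous function $Y\to\mathbb R$ extends to a continuous function on $Z$. *)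

(* Defs.v *)
From HB Require Import structures.
From mathcomp Require Import all_boot all_order all_algebra.
From mathcomp Require Import all_classical all_reals all_analysis.

Set Implicit Arguments.
Unset Strict Implicit.
Unset Printing Implicit Defensive.

Import Order.TTheory GRing.Theory Num.Theory.
Import numFieldNormedType.Exports.

Local Open Scope classical_set_scope.
Local Open Scope ring_scope.

Definition tychonoff_space (X : topologicalType) : Prop :=
  completely_regular_space X /\ hausdorff_space X.

Definition pseudocompact (R : realType) (X : topologicalType) : Prop :=
  forall f : X -> R, continuous f -> bounded_fun f.

Definition Cstar (R : realType) (X : topologicalType) : Type :=
  {f : X -> R | continuous f /\ bounded_fun f}.

HB.instance Definition _ (R : realType) (X : topologicalType) :=
  gen_eqMixin (Cstar R X).
HB.instance Definition _ (R : realType) (X : topologicalType) :=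
  gen_choiceMixin (Cstar R X).

Definition Cstar_embedded (R : realType) (Z : topologicalType) (Y : set Z) :
    Prop :=
  forall f : Cstar R Y,
    exists2 g : Z -> R, continuous g & forall y : Y, g (\val y) = sval f y.

(* Stone-Cech compactification: the closure of the image of X in the power
   R^(C^*(X)) under the evaluation map x |-> (f x)_f. *)
Section stone_cech.
Context (R : realType) (X : topologicalType).

Definition Cstar_eval (x : X) : {ptws (Cstar R X) -> R} := fun f => sval f x.

Definition stone_cech : Type := set_type (closure (range Cstar_eval)).

HB.instance Definition _ := Topological.on stone_cech.

Lemma Cstar_eval_closure (x : X) :
  Cstar_eval x \in closure (range Cstar_eval).
Proof. by apply/mem_set/subset_closure; exists x. Qed.

Definition to_stone_cech (x : X) : stone_cech :=
  exist _ (Cstar_eval x) (Cstar_eval_closure x).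

End stone_cech.

(* The measurable types of the library are pointed, whereas a space may be
   empty; the argument Z0 : $|Z| is a (proof-irrelevant) proof that Z has a
   point. *)
Section borel.
Context (Z : topologicalType) (Z0 : $|Z|).

Definition pointed_copy : Type := let _ := Z0 in Z.

HB.instance Definition _ := Choice.copy pointed_copy Z.
HB.instance Definition _ := isPointed.Build pointed_copy (unsquash Z0).

Definition borel : Type :=
  g_sigma_algebraType (@open Z : set (set pointed_copy)).

HB.instance Definition _ := Measurable.on borel.

End borel.

(* A [probability] of the library is a function on all subsets. Only its values
   on Borel sets are meaningful, so it is required to vanish on the other
   subsets: equality in P(Z) is then equality of measures on the Borel
   sigma-algebra. *)
Record radon_probability (R : realType) (Z : topologicalType) : Type :=
  RadonProbability {
    rp_inhabited : $|Z| ;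
    rp_measure :> probability (borel rp_inhabited) R ;
    rp_radon : forall (B : set (borel rp_inhabited)) (e : R),
      measurable B -> 0 < e ->
      exists K : set Z,
        [/\ compact K, K `<=` B & (rp_measure (B `\` K) < e%:E)%E] ;
    rp_nonmeasurable : forall B : set (borel rp_inhabited),
      ~ measurable B -> rp_measure B = 0%E
  }.

Section weak_topology.
Context (R : realType) (Z : topologicalType).

HB.instance Definition _ := gen_eqMixin (radon_probability R Z).
HB.instance Definition _ := gen_choiceMixin (radon_probability R Z).

Definition rp_integral (f : Z -> R) (mu : radon_probability R Z) : R :=
  \int[mu]_(x in [set: borel (rp_inhabited mu)]) f x.

HB.instance Definition _ := Topological.copy (radon_probability R Z)
  (sup_topology (fun f : Cstar R Z =>
    Topological.class (initial_topology (rp_integral (sval f))))).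

End weak_topology.

Definition finite_probability (R : realType) (Z : topologicalType)
    (A : set Z) : set (radon_probability R Z) :=
  [set mu | exists (n : nat) (x : 'I_n -> Z) (a : 'I_n -> R),
    [/\ forall i, A (x i),
        forall i, 0 <= a i,
        \sum_(i < n) a i = 1
      & forall B : set (borel (rp_inhabited mu)), measurable B ->
          mu B = (\sum_(i < n)
            (a i)%:E * \d_(x i : borel (rp_inhabited mu)) B)%E]].

Arguments to_stone_cech R {X} x.
Arguments finite_probability R {Z} A.

(* Main.v *)
(* Let j : X -> Z = beta X be the dense embedding and let f be continuous on Y.
   For each n the function x |-> f ((1/n) sum_i delta_(j (x i))) on X^n is
   continuous, and pseudocompactness of the powers of X (Frolik's argument)
   yields finite partitions of unity on X such that it varies little when every
   x i moves inside one set [u k <> 0].  Let e be the countable family of all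
   these partition functions.

   If y, y' in Y integrate every e i alike, then for any finite list of test
   functions both are approximated, on this list, by uniform measures on n
   points x i and x' i that can be paired inside common sets [u k <> 0], with n
   depending on the list only and not on the fineness of the partition.  Hence
   f y = f y'.

   As Y is pseudocompact, every mu in P(Z) agrees on all e i with some y in Y;
   then mu |-> f y is well defined, extends f, and is continuous, again by
   pseudocompactness of Y. *)

Require Import Defs.
From HB Require Import structures.
From mathcomp Require Import all_boot all_order all_algebra.
From mathcomp Require Import all_classical all_reals all_analysis.
From mathcomp Require Import measurable_realfun ring lra.

Set Implicit Arguments.
Unset Strict Implicit.
Unset Printing Implicit Defensive.

Import Order.TTheory GRing.Theory Num.Theory.
Import numFieldNormedType.Exports.

Local Open Scope classical_set_scope.
Local Open Scope ring_scope.

(** * Pseudocompact powers *)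

Lemma continuous_addr (R : realType) (X : topologicalType) (f g : X -> R) :
  continuous f -> continuous g -> continuous (fun x => f x + g x).
Proof. by move=> cf cg x; apply: cvgD; [exact: cf|exact: cg]. Qed.

Lemma continuous_subr (R : realType) (X : topologicalType) (f g : X -> R) :
  continuous f -> continuous g -> continuous (fun x => f x - g x).
Proof. by move=> cf cg x; apply: cvgB; [exact: cf|exact: cg]. Qed.

Lemma continuous_normr (R : realType) (X : topologicalType) (f : X -> R) :
  continuous f -> continuous (fun x => `|f x|).
Proof. by move=> cf x; apply: cvg_norm; exact: cf. Qed.

Lemma continuous_mulr (R : realType) (X : topologicalType) (f g : X -> R) :
  continuous f -> continuous g -> continuous (fun x => f x * g x).
Proof. by move=> cf cg x; apply: cvgM; [exact: cf|exact: cg]. Qed.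

Lemma continuous_sumr (R : realType) (X : topologicalType) (I : Type)
    (s : seq I) (f : I -> X -> R) :
  (forall i, continuous (f i)) -> continuous (fun x => \sum_(i <- s) f i x).
Proof.
move=> cf; elim: s => [|i s IH].
  by under eq_fun do rewrite big_nil; exact: cst_continuous.
by under eq_fun do rewrite big_cons; exact: continuous_addr.
Qed.

Lemma continuous_compT (X Y Z : topologicalType) (f : X -> Y) (g : Y -> Z) :
  continuous f -> continuous g -> continuous (fun x => g (f x)).
Proof. by move=> cf cg x; apply: continuous_comp; [exact: cf|exact: cg]. Qed.

(* Otherwise the sets [psi n <> 0] are locally finite, and the continuous
   function [sum_n n |psi n| / |psi n (x0 n)|] is unbounded. *)
Lemma pseudocompact_cluster (R : realType) (X : topologicalType)
    (psi : nat -> X -> R) :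
  pseudocompact R X -> (forall n, continuous (psi n)) ->
  (forall n, exists x, psi n x != 0) ->
  exists x : X, forall U : set X, nbhs x U -> forall N, exists n,
    (N <= n)%N /\ exists w, U w /\ psi n w != 0.
Proof.
move=> pcX cpsi nz; apply: contrapT => noclus.
have locfin (x : X) : exists2 U : set X, nbhs x U &
    exists N, forall n w, (N <= n)%N -> U w -> psi n w = 0.
  apply: contrapT => nx; apply: noclus; exists x => U xU N.
  apply: contrapT => nN; apply: nx; exists U => //; exists N => n w Nn Uw.
  apply/eqP; apply: contrapT => /negP psin.
  by apply: nN; exists n; split => //; exists w.
have [x0 psix0] := choice nz.
pose g n x := n%:R * (`|psi n x| / `|psi n (x0 n)|).
have g_ge0 n x : 0 <= g n x by rewrite !mulr_ge0.
have cg n : continuous (g n).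
  apply: continuous_mulr; first exact: cst_continuous.
  apply: continuous_mulr; last exact: cst_continuous.
  exact: continuous_normr.
have cS N : continuous (fun x => \sum_(n < N) g n x).
  by apply: continuous_sumr => i; exact: cg.
have stab (U : set X) N : (forall n w, (N <= n)%N -> U w -> psi n w = 0) ->
    forall w M, U w -> (N <= M)%N ->
      \sum_(n < M) g n w = \sum_(n < N) g n w.
  move=> UN w M Uw; elim: M => [|M IH]; first by rewrite leqn0 => /eqP ->.
  rewrite leq_eqVlt => /predU1P[<-//|]; rewrite ltnS => NM.
  by rewrite big_ord_recr /= IH// /g UN// normr0 mul0r mulr0 addr0.
have [N HN] : exists N : X -> nat, forall x : X, exists2 U : set X, nbhs x U &
    forall n w, (N x <= n)%N -> U w -> psi n w = 0.
  have /choice[N HN] : forall x : X, exists N, exists2 U : set X, nbhs x U &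
      forall n w, (N <= n)%N -> U w -> psi n w = 0.
    by move=> x; have [U xU [N HN]] := locfin x; exists N, U.
  by exists N.
(* [N x] need not be locally constant, but by [stab] longer truncations have the same value, so near
   [x] the function [f] is the fixed finite sum of length [N x]. *)
pose f x := \sum_(n < N x) g n x.
have fE x : forall M, (N x <= M)%N -> f x = \sum_(n < M) g n x.
  move=> M NM; have [U xU UN] := HN x.
  by rewrite (stab U (N x) UN x M) //; exact: nbhs_singleton.
have cf : continuous f.
  move=> x; have [U xU UN] := HN x.
  apply: (@cvg_trans _ ((fun w => \sum_(n < N x) g n w) w @[w --> x])).
    apply: near_eq_cvg; apply: filterS xU => w Uw.
    rewrite (fE w (maxn (N w) (N x))) ?leq_maxl//.
    by rewrite (stab U (N x) UN w) ?leq_maxr.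
  by apply: cS.
have [M [_ fM]] := pcX f cf.
have {}fM : forall x, `|f x| <= M + 1 by move=> x; apply: fM; rewrite ?ltrDl.
(* The normalisation of [g] makes the term of index [k] equal to [k > M + 1] at [x0 k]. *)
pose k := (Num.truncn (M + 1)).+1.
have kM : M + 1 < k%:R by rewrite /k; exact: truncnS_gt.
have := fM (x0 k); rewrite leNgt => /negP; apply; apply: lt_le_trans kM _.
apply: le_trans (ler_norm _).
rewrite (fE (x0 k) (maxn (N (x0 k)) k.+1)) ?leq_maxl//.
have km : (k < maxn (N (x0 k)) k.+1)%N by rewrite leq_max leqnn orbT.
rewrite (bigD1 (Ordinal km))//= {1}/g divff ?normr_eq0 ?psix0// mulr1 lerDl.
exact: sumr_ge0.
Qed.

(** Complete regularity stated through cozero sets: this form passes to powers and supplies the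
    functions needed by [pseudocompact_cluster]. *)
Definition cozero_base (R : realType) (X : topologicalType) : Prop :=
  forall (x : X) (U : set X), nbhs x U ->
  exists2 phi : X -> R, continuous phi &
    phi x != 0 /\ forall w, phi w != 0 -> U w.

Lemma completely_regular_cozero_base (R : realType) (X : topologicalType) :
  completely_regular_space X -> cozero_base R X.
Proof.
move=> crX x U; rewrite nbhsE => -[V [oV Vx] VU].
have /(@uniform_separatorP X R) [f [cf _ f0 f1]] :
    uniform_separator [set x] (~` V).
  by apply: crX; [exact: open_closedC|exact].
exists (fun w => 1 - f w).
  by apply: continuous_subr => //; exact: cst_continuous.
split=> [|w]; first by rewrite (f0 (f x)) ?subr0 ?oner_neq0//; exists x.
move=> fw; apply: VU; apply: contrapT => nVw; move/eqP: fw; apply.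
by rewrite (f1 (f w)) ?subrr//; exists w.
Qed.

(** Multiplying functions intersects cozero sets, so the sets containing a cozero neighbourhood of
    [x] form a filter, and only sets pulled back from one coordinate have to be treated. *)
Lemma cozero_base_ptws (R : realType) (I : eqType) (X : topologicalType) :
  cozero_base R X -> cozero_base R {ptws I -> X}.
Proof.
move=> cX x.
pose F : set_system {ptws I -> X} := [set U | exists2 phi : {ptws I -> X} -> R,
  continuous phi & phi x != 0 /\ forall w, phi w != 0 -> U w].
have FF : Filter F.
  split.
  - exists (cst 1); first exact: cst_continuous.
    by split => //; rewrite oner_neq0.
  - move=> U V [phi cphi [phix phiU]] [chi cchi [chix chiV]].
    exists (fun w => phi w * chi w).
      exact: continuous_mulr.
    split=> [|w]; first by rewrite mulf_neq0.
    by rewrite mulf_eq0 negb_or => /andP[/phiU ? /chiV].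
  - move=> U V UV [phi cphi [phix phiU]]; exists phi => //; split => // w.
    by move=> /phiU/UV.
suff : F --> x by move=> + U xU => /(_ U xU).
apply/cvg_sup => i U /= [_ [[V oV <-] Vx] VU].
have [phi cphi [phix phiV]] := cX (x i) V (open_nbhs_nbhs (conj oV Vx)).
exists (phi \o proj i).
  by apply: continuous_compT cphi; exact: proj_continuous.
by split=> // w /phiV ?; exact: VU.
Qed.

(* Frolik: if this fails at [x0], there are neighbourhoods [U n] of [x0],
   decreasing in [n], and cozero sets in [X * Z] on which [x] lies in [U n] and
   [f (x, z)] is far from [f (x', z)] for all [x'] in [U n.+1]. Near a cluster
   point of these sets this contradicts the continuity of [f]. *)
Lemma equicontinuous_of_pseudocompact_prod (R : realType)
    (X Z : topologicalType) (f : X * Z -> R) :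
  cozero_base R X -> cozero_base R Z -> pseudocompact R (X * Z)%type ->
  continuous f -> forall (x0 : X) (e : R), 0 < e ->
  \forall x \near x0, forall z, `|f (x, z) - f (x0, z)| <= e.
Proof.
move=> cX cZ pc cf x0 e e0; apply: contrapT => nequi.
have step (U : set X) : nbhs x0 U ->
    exists2 U' : set X, nbhs x0 U' /\ U' `<=` U &
    exists psi : X * Z -> R, [/\ continuous psi, (exists w, psi w != 0) &
      forall x z, psi (x, z) != 0 -> U x /\
        forall x', U' x' -> e / 2 < `|f (x', z) - f (x, z)|].
  move=> x0U.
  have [V [oV Vx0] VU] : exists2 V, open_nbhs x0 V & V `<=` U.
    by move: x0U; rewrite nbhsE.
  have [x [Vx [z xz]]] : exists x, V x /\
      exists z, e < `|f (x, z) - f (x0, z)|.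
    apply: contrapT => nV; apply: nequi.
    apply: filterS (open_nbhs_nbhs (conj oV Vx0)) => x Vx z.
    rewrite leNgt; apply/negP => xz.
    by apply: nV; exists x; split => //; exists z.
  (* Values near [(x, z)] and near [(x0, z)] each move by less than [e / 4], so of the gap [e] more
     than [e / 2] remains. *)
  have e40 : 0 < e / 4 by lra.
  have near_f w : nbhs w [set w' | `|f w - f w'| < e / 4].
    have /cvgrPdist_lt := cf w; exact.
  have [[A1 B1] [/= xA1 zB1] AB1] := near_f (x, z).
  have [[A2 B2] [/= xA2 zB2] AB2] := near_f (x0, z).
  have xVA : nbhs x (V `&` A1).
    by apply: filterI => //; exact: open_nbhs_nbhs.
  have zB : nbhs z (B1 `&` B2) by exact: filterI.
  have [phi cphi [phix phiV]] := cX _ _ xVA.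
  have [chi cchi [chiz chiB]] := cZ _ _ zB.
  exists (V `&` A2).
    split; last by move=> ? [/VU].
    exact: filterI (open_nbhs_nbhs (conj oV Vx0)) xA2.
  exists (fun w => phi w.1 * chi w.2); split.
  - apply: continuous_mulr.
      by apply: continuous_compT cphi => w; exact: cvg_fst.
    by apply: continuous_compT cchi => w; exact: cvg_snd.
  - by exists (x, z); rewrite mulf_neq0.
  - move=> x1 z1 /=; rewrite mulf_eq0 negb_or => /andP[/phiV[Vx1 A1x1]].
    move=> /chiB[B1z1 B2z1]; split; first exact: VU.
    move=> x' [_ A2x'].
    have /= h1 := AB1 (x1, z1) (conj A1x1 B1z1).
    have /= h2 := AB2 (x', z1) (conj A2x' B2z1).
    move: h1 h2 xz; set a := f (x, z); set b := f (x0, z).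
    set c := f (x1, z1); set d := f (x', z1).
    have := ler_distD c a b; have := ler_distD d c b.
  by rewrite (distrC c d) (distrC d b); lra.
pose T := {U : set X | nbhs x0 U}.
pose P (U : T) (V : T * (X * Z -> R)) := [/\ sval V.1 `<=` sval U,
  continuous V.2, (exists w, V.2 w != 0) &
  forall x z, V.2 (x, z) != 0 -> sval U x /\
        forall x', sval V.1 x' -> e / 2 < `|f (x', z) - f (x, z)|].
have /choice[next nextP] : forall U : T, exists V, P U V.
  move=> [U xU]; have [U' [xU' U'U] [psi [? ? ?]]] := step U xU.
  by exists (exist _ U' xU', psi).
have x0T : nbhs x0 setT by exact: filterT.
pose U n := iter n (fun V => (next V).1) (exist _ setT x0T : T).
pose psi n := (next (U n)).2.
have UP n : P (U n) (U n.+1, psi n).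
  by rewrite /psi /= -surjective_pairing; exact: nextP.
have Udecr n m : (n <= m)%N -> sval (U m) `<=` sval (U n).
  elim: m => [|m IH]; first by rewrite leqn0 => /eqP ->.
  rewrite leq_eqVlt => /predU1P[->//|]; rewrite ltnS => /IH.
  apply: subset_trans.
  by have [] := UP m.
have [|n|[x z] clus] := @pseudocompact_cluster R _ psi pc.
- by move=> n; have [] := UP n.
- by have [] := UP n.
have e40 : 0 < e / 4 by lra.
have : nbhs (x, z) [set w' | `|f (x, z) - f w'| < e / 4].
  have /cvgrPdist_lt := cf (x, z); exact.
move=> [[A B] [/= xA zB] AB].
have xzAB : nbhs (x, z) (A `*` B) by exists (A, B).
(* Two hits [n < m] of the same box: [x2] lies in [U m], hence in [U n.+1], so [f] differs by more
   than [e / 2] between [(x1, z1)] and [(x2, z1)], although both are in the box. *)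
have [n [_ [[x1 z1] [[/= Ax1 Bz1] psi1]]]] := clus _ xzAB 0%N.
have [m [nm [[x2 z2] [[/= Ax2 Bz2] psi2]]]] := clus _ xzAB n.+1.
have [_ _ _ /(_ _ _ psi1)[_ dev]] := UP n.
have [_ _ _ /(_ _ _ psi2)[Umx2 _]] := UP m.
have /= h := dev x2 (Udecr _ _ nm _ Umx2).
have /= h1 := AB (x1, z1) (conj Ax1 Bz1).
have /= h2 := AB (x2, z1) (conj Ax2 Bz1).
move: h h1 h2; set a := f (x, z); set b := f (x1, z1); set c := f (x2, z1).
by have := ler_distD a c b; rewrite (distrC c a); lra.
Qed.

Lemma bounded_funP (R : realType) (X : Type) (f : X -> R) :
  bounded_fun f <-> exists M : R, forall x, `|f x| <= M.
Proof.
split=> [[M [_ fM]]|[M fM]].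
  by exists (M + 1) => x; apply: fM; rewrite ?ltrDl.
exists M; split; first exact: num_real.
by move=> M' MM' x _; exact: le_trans (fM x) (ltW MM').
Qed.

Lemma pseudocompact_surj (R : realType) (X Y : topologicalType) (g : X -> Y) :
  continuous g -> (forall y, exists x, g x = y) ->
  pseudocompact R X -> pseudocompact R Y.
Proof.
move=> cg sg pcX f cf.
have /bounded_funP[M fM] := pcX (f \o g) (continuous_compT cg cf).
by apply/bounded_funP; exists M => y; have [x <-] := sg y; exact: fM.
Qed.

Lemma continuous_to_ptws (I : Type) (W X : topologicalType)
    (h : W -> {ptws I -> X}) :
  (forall i, continuous (fun w => h w i)) -> continuous h.
Proof.
move=> ch w; apply/cvg_sup => i U /= [_ [[V oV <-] Vx] VU].
have hV : nbhs w [set w' | V (h w' i)] :=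
  ch i w _ (open_nbhs_nbhs (conj oV Vx)).
suff : nbhs w [set w' | U (h w')] by [].
by apply: filterS hV => w' /= ?; exact: VU.
Qed.

Lemma continuous_ptws_proj (I : eqType) (X : topologicalType) (i : I) :
  continuous (fun h : {ptws I -> X} => h i).
Proof. exact: (@proj_continuous I (fun=> X) i). Qed.

Lemma continuous_pairT (W X Y : topologicalType) (f : W -> X) (g : W -> Y) :
  continuous f -> continuous g -> continuous (fun w => (f w, g w)).
Proof. by move=> cf cg w; apply: cvg_pair; [exact: cf|exact: cg]. Qed.

(** * Partitions of unity on pseudocompact spaces and their powers *)

Definition partition_of_unity (R : realType) (X : topologicalType) (r : nat)
    (u : 'I_r -> X -> R) : Prop :=
  [/\ forall k, continuous (u k), forall k x, 0 <= u k x
    & forall x, \sum_(k < r) u k x = 1].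

Lemma partition_of_unity_cst1 (R : realType) (X : topologicalType) :
  partition_of_unity (fun (_ : 'I_1) (_ : X) => 1 : R).
Proof.
split=> [_|//|x]; first exact: cst_continuous.
by rewrite big_ord1.
Qed.

(** The supremum over [t] of [|F t x - F t p|] is a continuous pseudometric. Pseudocompactness makes
    it totally bounded, and normalised bumps around a finite net form the partition. *)
Lemma equicontinuous_partition (R : realType) (X : topologicalType) (T : Type)
    (F : T -> X -> R) (M : R) :
  pseudocompact R X -> (forall t x, `|F t x| <= M) ->
  (forall (x0 : X) (e : R), 0 < e ->
    \forall x \near x0, forall t, `|F t x - F t x0| <= e) ->
  forall e : R, 0 < e -> exists (r : nat) (u : 'I_r -> X -> R),
    partition_of_unity u /\ forall k x x', u k x != 0 -> u k x' != 0 ->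
      forall t, `|F t x - F t x'| <= e.
Proof.
move=> pcX FM eqF e e0.
(* An empty [T] is set apart, since [d] would be a supremum over the empty set. *)
have [[t0 _]|T0] := pselect (exists t : T, True); last first.
  exists 1%N, (fun _ _ => 1); split; first exact: partition_of_unity_cst1.
  by move=> k x x' _ _ t; exfalso; apply: T0; exists t.
pose d x p := sup (range (fun t => `|F t x - F t p|)).
have dub x p t : `|F t x - F t p| <= d x p.
  apply: ub_le_sup; last by exists t.
  exists (M + M) => _ [s _ <-].
  by apply: le_trans (ler_normB _ _) _; exact: lerD.
have dle x p c : (forall t, `|F t x - F t p| <= c) -> d x p <= c.
  move=> h; apply: ge_sup; first by exists `|F t0 x - F t0 p|; exists t0.
  by move=> _ [s _ <-].
have dsym x p : d x p = d p x.
  by rewrite /d; congr sup; apply: eq_imagel => t _; rewrite distrC.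
have dtri x y p : d x p <= d x y + d y p.
  apply: dle => t; apply: le_trans (ler_distD (F t y) _ _) _.
  by apply: lerD; exact: dub.
have dxx x : d x x <= 0 by apply: dle => t; rewrite subrr normr0.
have cd p : continuous (d^~ p).
  move=> x0; apply/cvgrPdist_le => c c0.
  apply: filterS (eqF x0 c c0) => x /dle dx.
  have := dtri x0 x p; have := dtri x x0 p; rewrite (dsym x0 x) => h1 h2.
  by rewrite ler_norml; lra.
(* Twice the positive part: continuous in [a], and nonzero exactly when [a > 0]. *)
pose pos (a : R) := a + `|a|.
have pos_ge0 a : 0 <= pos a by rewrite /pos; case: ler0P; lra.
have posN0 a : pos a != 0 -> 0 < a.
  by rewrite /pos; case: ler0P => // h; rewrite subrr eqxx.
have pos_gt0 a : 0 < a -> 0 < pos a.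
  by move=> a0; rewrite /pos gtr0_norm//; lra.
have cpos p c : continuous (fun x => pos (c - d x p)).
  have cc : continuous (fun x => c - d x p).
    by apply: continuous_subr; [exact: cst_continuous|exact: cd].
  by apply: continuous_addr => //; exact: continuous_normr.
have e20 : 0 < e / 2 by lra.
(* Without a finite net, greedy choice gives an [e / 2]-separated sequence [g (S n)]. Bumps of
   radius [e / 8] around its terms would cluster at some [x], bringing two terms closer than
   [4 * (e / 8)]. *)
have [s sP] : exists s : seq X, forall x, exists2 p, p \in s & d x p < e / 2.
  apply: contrapT => nots.
  have /choice[g gP] : forall s : seq X, exists x,
      forall p, p \in s -> e / 2 <= d x p.
    move=> s; apply: contrapT => nx; apply: nots; exists s => x.
    apply: contrapT => np; apply: nx; exists x => p ps.
    by rewrite leNgt; apply/negP => dxp; apply: np; exists p.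
  pose S n := iter n (fun s => g s :: s) [::].
  have qS m n : (m < n)%N -> g (S m) \in S n.
    elim: n => [//|n IH]; rewrite ltnS leq_eqVlt => /predU1P[->|mn].
      by rewrite /= inE eqxx.
    by rewrite /= inE IH// orbT.
  pose psi n x := pos (e / 8 - d x (g (S n))).
  have [||x clus] := @pseudocompact_cluster R X psi pcX.
  - by move=> n; exact: cpos.
  - move=> n; exists (g (S n)); rewrite gt_eqF// pos_gt0//.
    by have := dxx (g (S n)); lra.
  have xU : nbhs x [set w | d w x < e / 8].
    have e80 : 0 < e / 8 by lra.
    apply: filterS (eqF x (e / 16) _) => [w /dle /= h|]; last by lra.
    by apply: le_lt_trans h _; lra.
  have [n [_ [w1 [/= w1x /posN0 w1q]]]] := clus _ xU 0%N.
  have [m [nm [w2 [/= w2x /posN0 w2q]]]] := clus _ xU n.+1.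
  have := gP _ _ (qS _ _ nm).
  have := dtri (g (S m)) w2 (g (S n)); have := dtri w2 x (g (S n)).
  have := dtri x w1 (g (S n)); rewrite (dsym x w1) (dsym (g (S m)) w2).
  by lra.
pose v (k : 'I_(size s)) x := pos (e / 2 - d x (tnth (in_tuple s) k)).
have v_ge0 k x : 0 <= v k x by exact: pos_ge0.
pose V x := \sum_(k < size s) v k x.
have V0 x : 0 < V x.
  have [p ps xp] := sP x.
  have ips : (index p s < size s)%N by rewrite index_mem.
  rewrite /V (bigD1 (Ordinal ips))//=; apply: ltr_pwDl; last exact: sumr_ge0.
  by apply: pos_gt0; rewrite (tnth_nth p) /= nth_index//; lra.
have cV : continuous V by apply: continuous_sumr => k; exact: cpos.
exists (size s), (fun k x => v k x / V x); split.
  split=> [k|k x|x].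
  - apply: continuous_mulr; first exact: cpos.
    by move=> x; apply: cvgV; [rewrite gt_eqF|exact: cV].
  - by rewrite divr_ge0// ltW.
  - by rewrite -mulr_suml -/(V x) divff// gt_eqF.
move=> k x x'; rewrite !mulf_eq0 !negb_or => /andP[/posN0 kx _].
move=> /andP[/posN0 kx' _] t; apply: le_trans (dub x x' t) _.
have := dtri x (tnth (in_tuple s) k) x'.
by rewrite (dsym (tnth (in_tuple s) k)); lra.
Qed.

(** One coordinate moves at a time while the others are parameters: the slices are equicontinuous by
    [equicontinuous_of_pseudocompact_prod], and a single partition serves all coordinates. *)
Lemma power_partition (R : realType) (X : topologicalType) (n : nat)
    (f : {ptws 'I_n -> X} -> R) :
  cozero_base R X -> (forall m, pseudocompact R {ptws 'I_m -> X}) ->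
  continuous f -> forall e : R, 0 < e -> exists (r : nat) (u : 'I_r -> X -> R),
    partition_of_unity u /\ forall x x' : 'I_n -> X,
      (forall i, exists k, u k (x i) != 0 /\ u k (x' i) != 0) ->
      `|f x - f x'| <= e.
Proof.
move=> cX pc cf e e0.
case: n f cf => [|n] f cf.
  exists 1%N, (fun _ _ => 1); split; first exact: partition_of_unity_cst1.
  move=> x x' _; suff -> : x = x' by rewrite subrr normr0 ltW.
  by apply/funext => -[].
pose upd (i : 'I_n.+1) (z : {ptws 'I_n.+1 -> X}) (a : X) :
  {ptws 'I_n.+1 -> X} := fun j => if j == i then a else z j.
have cupd i : continuous (fun w : X * {ptws 'I_n.+1 -> X} => f (upd i w.2 w.1)).
  apply: continuous_compT cf; apply: continuous_to_ptws => j; rewrite /upd.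
  case: eqP => _; first by move=> w; exact: cvg_fst.
  apply: (@continuous_compT _ _ _ snd (fun h : {ptws 'I_n.+1 -> X} => h j)).
    by move=> w; exact: cvg_snd.
  exact: continuous_ptws_proj.
have pcX : pseudocompact R X.
  apply: (pseudocompact_surj _ _ (pc 1%N)).
    exact: (@continuous_ptws_proj _ _ ord0).
  by move=> x; exists (fun=> x).
have pcXX : pseudocompact R (X * {ptws 'I_n.+1 -> X})%type.
  apply: (@pseudocompact_surj _ _ _
    (fun h : {ptws 'I_n.+2 -> X} =>
      (h ord0, (fun i => h (lift ord0 i)) : {ptws 'I_n.+1 -> X}))
    _ _ (pc n.+2)).
    apply: continuous_pairT; first exact: continuous_ptws_proj.
    by apply: continuous_to_ptws => i; exact: continuous_ptws_proj.
  move=> [x z].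
  exists (fun i => if unlift ord0 i is Some j then z j else x).
  by rewrite unlift_none; congr pair; apply/funext => i; rewrite liftK.
have /bounded_funP[M fM] := pc _ f cf.
pose F (t : 'I_n.+1 * {ptws 'I_n.+1 -> X}) x := f (upd t.1 t.2 x).
have en0 : 0 < e / n.+1%:R by rewrite divr_gt0.
have [||r [u [pu uF]]] := @equicontinuous_partition R X _ F M pcX _ _ _ en0.
- by move=> t x; exact: fM.
- move=> x0 c c0.
  have : \forall x \near x0, forall i z, `|F (i, z) x - F (i, z) x0| <= c.
    apply: filter_forall => i.
    exact: (equicontinuous_of_pseudocompact_prod cX (cozero_base_ptws cX)
      pcXX (cupd i) x0 c0).
  by apply: filterS => x h [i z]; exact: h.
exists r, u; split=> // x x' xx'.
(* The first [m] coordinates come from [x'], the others from [x]; each increase of [m] costs at most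
   [e / n.+1]. *)
pose hyb m : {ptws 'I_n.+1 -> X} := fun i => if (i < m)%N then x' i else x i.
have hybE m : (m <= n.+1)%N -> `|f x - f (hyb m)| <= m%:R * (e / n.+1%:R).
  elim: m => [_|m IH mn].
    have -> : hyb 0%N = x by apply/funext.
    by rewrite subrr normr0 mul0r.
  apply: le_trans (ler_distD (f (hyb m)) _ _) _.
  rewrite -natr1 mulrDl mul1r; apply: lerD; first exact: IH (ltnW mn).
  pose i := Ordinal mn; have [k [kx kx']] := xx' i.
  have -> : hyb m = upd i (hyb m) (x i).
    apply/funext => j; rewrite /upd /hyb; case: eqP => // ->.
    by rewrite ltnn.
  have -> : hyb m.+1 = upd i (hyb m) (x' i).
    apply/funext => j; rewrite /upd /hyb ltnS leq_eqVlt.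
    have -> : (nat_of_ord j == m) = (j == i) by [].
    by case: eqP => // ->.
  exact: uF k _ _ kx kx' (i, hyb m).
have -> : x' = hyb n.+1 by apply/funext => i; rewrite /hyb ltn_ord.
apply: le_trans (hybE _ (leqnn _)) _.
by rewrite mulrC divfK ?pnatr_eq0.
Qed.

(** * Radon probability measures *)

Section radon_integral.
Context (R : realType) (Z : topologicalType).
Implicit Types (f g : Z -> R) (mu : radon_probability R Z).

Lemma continuous_borel_measurable (Z0 : $|Z|) f :
  continuous f -> measurable_fun setT (f : borel Z0 -> R).
Proof.
move=> /continuousP cf; apply: (measurability _ (RGenOpens.measurableE R)).
move=> _ [_ [a [b ->] <-]]; rewrite setTI; apply: sub_sigma_algebra.
exact/cf/interval_open.
Qed.

Lemma continuous_bounded_integrable mu f : continuous f -> bounded_fun f ->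
  mu.-integrable setT (EFin \o (f : borel (rp_inhabited mu) -> R)).
Proof.
move=> cf bf; apply: measurable_bounded_integrable => //.
  by rewrite (le_lt_trans (probability_le1 _ _))// ltry.
exact: continuous_borel_measurable.
Qed.

Lemma rp_integralD mu f g : continuous f -> bounded_fun f ->
  continuous g -> bounded_fun g ->
  rp_integral (fun z => f z + g z) mu = rp_integral f mu + rp_integral g mu.
Proof.
by move=> cf bf cg bg; apply: RintegralD => //;
  exact: continuous_bounded_integrable.
Qed.

Lemma rp_integralZ mu f c : continuous f -> bounded_fun f ->
  rp_integral (fun z => c * f z) mu = c * rp_integral f mu.
Proof.
by move=> cf bf; apply: RintegralZl => //; exact: continuous_bounded_integrable.
Qed.

Lemma rp_integral_cst mu c : rp_integral (cst c) mu = c.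
Proof.
rewrite /rp_integral Rintegral_cst// -[RHS]mulr1; congr (_ * _).
by rewrite -[RHS]/(fine 1%E); congr fine; exact: probability_setT.
Qed.

Lemma le_rp_integral mu f g : continuous f -> bounded_fun f ->
  continuous g -> bounded_fun g -> (forall z, f z <= g z) ->
  rp_integral f mu <= rp_integral g mu.
Proof.
by move=> cf bf cg bg fg; apply: le_Rintegral => //;
  exact: continuous_bounded_integrable.
Qed.

Lemma bounded_funD f g : bounded_fun f -> bounded_fun g ->
  bounded_fun (fun z => f z + g z).
Proof.
move=> /bounded_funP[M fM] /bounded_funP[N gN].
apply/bounded_funP; exists (M + N) => z.
by apply: le_trans (ler_normD _ _) _; exact: lerD.
Qed.

Lemma bounded_funZ f c : bounded_fun f -> bounded_fun (fun z => c * f z).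
Proof.
move=> /bounded_funP[M fM]; apply/bounded_funP; exists (`|c| * M) => z.
by rewrite normrM ler_wpM2l.
Qed.

Lemma bounded_fun_cst (c : R) : bounded_fun (fun _ : Z => c).
Proof. by apply/bounded_funP; exists `|c|. Qed.

Lemma bounded_fun_sum (I : Type) (s : seq I) (f : I -> Z -> R) :
  (forall i, bounded_fun (f i)) -> bounded_fun (fun z => \sum_(i <- s) f i z).
Proof.
move=> bf; elim: s => [|i s IH].
  rewrite (_ : (fun z => _) = fun=> 0); first exact: bounded_fun_cst.
  by apply/funext => z; rewrite big_nil.
rewrite (_ : (fun z => _) = fun z => f i z + \sum_(j <- s) f j z).
  exact: bounded_funD.
by apply/funext => z; rewrite big_cons.
Qed.

Lemma rp_integral_sum mu (I : Type) (s : seq I) (c : I -> R) (f : I -> Z -> R) :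
  (forall i, continuous (f i)) -> (forall i, bounded_fun (f i)) ->
  rp_integral (fun z => \sum_(i <- s) c i * f i z) mu =
  \sum_(i <- s) c i * rp_integral (f i) mu.
Proof.
move=> cf bf; elim: s => [|i s IH].
  rewrite big_nil (_ : (fun z => _) = cst 0) ?rp_integral_cst//.
  by apply/funext => z; rewrite big_nil.
rewrite (_ : (fun z => _) =
    fun z => c i * f i z + \sum_(j <- s) c j * f j z); last first.
  by apply/funext => z; rewrite big_cons.
rewrite big_cons -IH -rp_integralZ//; apply: rp_integralD.
- by apply: continuous_mulr => //; exact: cst_continuous.
- exact: bounded_funZ.
- apply: continuous_sumr => j.
  by apply: continuous_mulr => //; exact: cst_continuous.
- by apply: bounded_fun_sum => j; exact: bounded_funZ.
Qed.

End radon_integral.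

(** * Uniform measures on finitely many points *)

Section uniform_probability.
Context (R : realType) (Z : topologicalType) (n : nat) (x : 'I_n.+1 -> Z).

Let Z0 : $|Z| := squash (x ord0).
Let w : {nonneg R} := (n.+1%:R^-1)%:nng.
Let dsum := mscale w (msum (fun k => \d_(x (inord k) : borel Z0)) n.+1).

(* Cut off to [0] outside the Borel sets, as [rp_nonmeasurable] demands. *)
Definition uniform_measure (B : set (borel Z0)) : \bar R :=
  if `[< measurable B >] then dsum B else 0%E.

Let uniform_measureE B : measurable B -> uniform_measure B = dsum B.
Proof. by rewrite /uniform_measure => /asboolT ->. Qed.

Let uniform_measure0 : uniform_measure set0 = 0%E.
Proof. by rewrite uniform_measureE// measure0. Qed.

Let uniform_measure_ge0 B : (0 <= uniform_measure B)%E.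
Proof. by rewrite /uniform_measure; case: ifP. Qed.

Let uniform_measure_sigma_additive : semi_sigma_additive uniform_measure.
Proof.
move=> F mF tF mUF; rewrite uniform_measureE//.
under eq_fun do under eq_bigr do rewrite uniform_measureE//.
exact: measure_semi_sigma_additive.
Qed.

HB.instance Definition _ := isMeasure.Build _ _ _ uniform_measure
  uniform_measure0 uniform_measure_ge0 uniform_measure_sigma_additive.

Let dsumE B : dsum B =
  (\sum_(i < n.+1) (n.+1%:R^-1)%:E * \d_(x i : borel Z0) B)%E.
Proof.
rewrite /dsum/= /mscale/= /msum ge0_sume_distrr//.
by apply: eq_bigr => i _; rewrite inord_val.
Qed.

Let uniform_measureT : uniform_measure setT = 1%E.
Proof.
rewrite uniform_measureE// dsumE.
under eq_bigr do rewrite diracT mule1.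
by rewrite sumEFin sumr_const card_ord -[X in X%:E]mulr_natr mulVf ?pnatr_eq0.
Qed.

HB.instance Definition _ := Measure_isProbability.Build _ _ _
  uniform_measure uniform_measureT.

Let uniform_radon (B : set (borel Z0)) (e : R) : measurable B -> 0 < e ->
  exists K : set Z,
    [/\ compact K, K `<=` B & (uniform_measure (B `\` K) < e%:E)%E].
Proof.
(* The atoms lying in [B] form a finite, hence compact, set carrying all the mass of [B]. *)
move=> mB e0; exists (B `&` range x); split.
- by apply: finite_compact; apply: finite_setIr; exact: finite_image.
- by move=> z [].
- rewrite /uniform_measure; case: ifP => _; rewrite ?lte_fin// dsumE.
  rewrite big1 ?lte_fin// => i _; rewrite diracE memNset ?mule0//.
  by move=> [Bxi]; apply; split => //; exists i.
Qed.

Let uniform_nonmeasurable (B : set (borel Z0)) :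
  ~ measurable B -> uniform_measure B = 0%E.
Proof. by move=> mB; rewrite /uniform_measure asboolF. Qed.

Definition uniform_probability : radon_probability R Z :=
  @RadonProbability R Z Z0 uniform_measure uniform_radon uniform_nonmeasurable.

Lemma finite_uniform_probability (A : set Z) :
  (forall i, A (x i)) -> finite_probability R A uniform_probability.
Proof.
move=> Ax; exists n.+1, x, (fun=> n.+1%:R^-1); split=> //.
  by rewrite sumr_const card_ord -[LHS]mulr_natr mulVf ?pnatr_eq0.
by move=> B mB; rewrite -dsumE; exact: uniform_measureE.
Qed.

(** The integral splits over a sum of measures for nonnegative functions; adding a bound [M] of [f]
    reduces to that case. *)
Lemma rp_integral_uniform (f : Z -> R) : continuous f -> bounded_fun f ->
  rp_integral f uniform_probability = n.+1%:R^-1 * \sum_(i < n.+1) f (x i).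
Proof.
move=> cf bf.
have pos_case (g : Z -> R) : continuous g -> (forall z, 0 <= g z) ->
    rp_integral g uniform_probability = n.+1%:R^-1 * \sum_(i < n.+1) g (x i).
  move=> cg g0; rewrite /rp_integral /Rintegral.
  have /measurable_EFinP mg := @continuous_borel_measurable R Z Z0 g cg.
  rewrite (@eq_measure_integral _ _ _ setT dsum); last first.
    by move=> B mB _; exact: uniform_measureE.
  rewrite /dsum ge0_integral_mscale//; last by move=> z _; rewrite lee_fin.
  rewrite ge0_integral_measure_sum//; last by move=> z _; rewrite lee_fin.
  under eq_bigr do rewrite integral_dirac// diracT mul1e inord_val.
  by rewrite sumEFin.
have /bounded_funP[M fM] := bf.
have fM0 z : 0 <= f z + M.
  by have := fM z; rewrite ler_norml => /andP[]; lra.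
have cM : continuous (fun z => f z + M).
  by apply: continuous_addr => //; exact: cst_continuous.
have := pos_case _ cM fM0.
rewrite (rp_integralD _ cf bf (fun z => @cst_continuous _ _ M z)
  (bounded_fun_cst Z M)) rp_integral_cst big_split/= sumr_const card_ord mulrDr.
by rewrite -[X in _ + _ * X]mulr_natl mulKf ?pnatr_eq0// => /addIr.
Qed.

End uniform_probability.

(** * The weak topology *)

Section weak_topology_theory.
Context (R : realType) (Z : topologicalType).
Implicit Types (mu nu : radon_probability R Z) (H : seq (Cstar R Z)).

Lemma rp_integral_continuous (h : Cstar R Z) :
  continuous (rp_integral (sval h) : radon_probability R Z -> R).
Proof.
move=> mu; have /cvg_sup/(_ h) cvgh : nbhs mu --> mu by [].
move=> U hU; apply: cvgh.
exact: (@initial_continuous _ _ (rp_integral (sval h)) mu U hU).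
Qed.

Lemma continuous_to_radon_probability (W : topologicalType)
    (g : W -> radon_probability R Z) :
  (forall h : Cstar R Z, continuous (fun w => rp_integral (sval h) (g w))) ->
  continuous g.
Proof.
move=> cg w; apply/cvg_sup => h U /= [_ [[V oV <-] Vx] VU].
have hV : nbhs w [set w' | V (rp_integral (sval h) (g w'))] :=
  cg h w _ (open_nbhs_nbhs (conj oV Vx)).
suff : nbhs w [set w' | U (g w')] by [].
by apply: filterS hV => w' /= ?; exact: VU.
Qed.

(** The sets [U] satisfying the conclusion form a filter, so its convergence to [mu] need only be
    tested in each generating initial topology, where one function suffices. *)
Lemma nbhs_radon_probability mu (U : set (radon_probability R Z)) :
  nbhs mu U -> exists H, exists2 d : R, 0 < d &
    forall nu, (forall h, h \in H ->
      `|rp_integral (sval h) nu - rp_integral (sval h) mu| < d) -> U nu.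
Proof.
pose F : set_system (radon_probability R Z) :=
  [set U | exists H, exists2 d : R, 0 < d & forall nu, (forall h, h \in H ->
      `|rp_integral (sval h) nu - rp_integral (sval h) mu| < d) -> U nu].
have FF : Filter F.
  split.
  - by exists [::], 1.
  - move=> A B [H1 [d1 d10 H1A]] [H2 [d2 d20 H2B]].
    exists (H1 ++ H2), (Num.min d1 d2); first by rewrite lt_min d10.
    move=> nu nuH; split.
      apply: H1A => h hH; have := nuH h; rewrite mem_cat hH lt_min.
      by move=> /(_ isT)/andP[].
    apply: H2B => h hH; have := nuH h; rewrite mem_cat hH orbT lt_min.
    by move=> /(_ isT)/andP[].
  - move=> A B AB [H [d d0 HA]]; exists H, d => // nu /HA; exact: AB.
suff : F --> mu by move=> + muU => /(_ U muU).
apply/cvg_sup => h A /= [_ [[V oV <-] Vmu] VA].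
have : nbhs (rp_integral (sval h) mu) V by exact: open_nbhs_nbhs.
move=> /nbhs_ballP[d /= d0 dV].
exists [:: h], d => // nu /(_ h); rewrite inE eqxx => /(_ isT) nud.
by apply: VA; apply: dV; rewrite /ball/= distrC.
Qed.

End weak_topology_theory.

Lemma continuous_to_set_type (W T : topologicalType) (A : set T) (g : W -> A) :
  continuous (fun w => \val (g w)) -> continuous g.
Proof.
move=> cg w U /= [_ [[V oV <-] Vx] VU].
have hV : nbhs w [set w' | V (\val (g w'))] :=
  cg w _ (open_nbhs_nbhs (conj oV Vx)).
suff : nbhs w [set w' | U (g w')] by [].
by apply: filterS hV => w' /= ?; exact: VU.
Qed.

Lemma continuous_val (T : topologicalType) (A : set T) :
  continuous (fun a : A => \val a).
Proof. exact: (@initial_continuous _ _ (@set_val T A)). Qed.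

Lemma nbhs_set_type (T : topologicalType) (A : set T) (a : A) (U : set A) :
  nbhs a U -> exists2 V : set T, nbhs (\val a) V & forall b, V (\val b) -> U b.
Proof.
move=> [_ [[V oV <-] Va] VU]; exists V; first exact: open_nbhs_nbhs.
by move=> b ?; exact: VU.
Qed.

Lemma dense_ge0 (R : realType) (X Z : topologicalType) (j : X -> Z)
    (g : Z -> R) :
  closure (range j) = setT -> continuous g -> (forall x, 0 <= g (j x)) ->
  forall z, 0 <= g z.
Proof.
move=> dj cg g0 z; rewrite leNgt; apply/negP => gz.
have : closure (range j) z by rewrite dj.
have Uz : nbhs z [set w | g w < 0] by exact: cg (lt_nbhsl gz).
by move=> /(_ _ Uz)[_ [[x _ <-] /=]]; rewrite ltNge g0.
Qed.

(** * Approximation of two measures by paired samples *)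

Section sampling.
Context (R : realType) (X Z : topologicalType) (j : X -> Z).
Hypothesis dj : closure (range j) = setT.
Implicit Types (mu nu : radon_probability R Z).

Definition Cstar_partition (r : nat) (u : 'I_r -> Z -> R) : Prop :=
  partition_of_unity u /\ forall k, bounded_fun (u k).

(* Otherwise [h + h'] exceeds [c] on every product of two copies of
   [u k <> 0]; with [s k] the infimum of [h] on [u k <> 0] this gives
   [sum s_k u_k <= h] and [sum (c - s_k) u_k <= h'], to be integrated. *)
Lemma exists_below_integral (r : nat) (u : 'I_r -> Z -> R) mu nu
    (h h' : Z -> R) (t : R) :
  Cstar_partition u ->
  (forall k, rp_integral (u k) mu = rp_integral (u k) nu) ->
  continuous h -> bounded_fun h -> continuous h' -> bounded_fun h' -> 0 < t ->
  exists k x x', [/\ u k (j x) != 0, u k (j x') != 0 &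
    h (j x) + h' (j x') <= rp_integral h mu + rp_integral h' nu + t].
Proof.
move=> [[cu u0 u1] bu] uE ch bh ch' bh' t0; apply: contrapT => nex.
set c := rp_integral h mu + rp_integral h' nu + t in nex.
have hc k x x' : u k (j x) != 0 -> u k (j x') != 0 ->
    c < h (j x) + h' (j x').
  move=> ux ux'; rewrite ltNge; apply/negP => hle.
  by apply: nex; exists k, x, x'.
pose A k := [set h (j x) | x in [set x | u k (j x) != 0]].
(* If [u k] vanishes on the image of [j], then [A k] is empty and [s k] a default value; this is
   harmless, as [s k] is only compared at points with [u k (j x) != 0]. *)
pose s k := inf (A k).
have /bounded_funP[M hM] := bh.
have lbA k : has_lbound (A k).
  exists (- M) => _ [x _ <-].
  by have := hM (j x); rewrite ler_norml => /andP[].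
have cus (a : 'I_r -> R) : continuous (fun z => \sum_(k < r) a k * u k z).
  by apply: continuous_sumr => k; apply: continuous_mulr => //;
      exact: cst_continuous.
have bus (a : 'I_r -> R) : bounded_fun (fun z => \sum_(k < r) a k * u k z).
  by apply: bounded_fun_sum => k; exact: bounded_funZ.
(* On the dense image of [j] the sum is a weighted mean of those [a k] with [u k (j x) != 0]. *)
have le_dense (a : 'I_r -> R) (g : Z -> R) : continuous g ->
    (forall k x, u k (j x) != 0 -> a k <= g (j x)) ->
    forall z, \sum_(k < r) a k * u k z <= g z.
  move=> cg ag z; rewrite -subr_ge0.
  apply: (@dense_ge0 _ _ _ j (fun z => g z - \sum_(k < r) a k * u k z) dj).
    exact: continuous_subr.
  move=> x; rewrite subr_ge0 -[leRHS]mulr1 -(u1 (j x)) mulr_sumr.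
  apply: ler_sum => k _; have [->|ux] := eqVneq (u k (j x)) 0.
    by rewrite !mulr0.
  by apply: ler_wpM2r => //; exact: ag.
have sh : \sum_(k < r) s k * rp_integral (u k) mu <= rp_integral h mu.
  rewrite -rp_integral_sum//; apply: le_rp_integral => //.
  apply: le_dense => // k x ux.
  by apply: ge_inf => //; exists x.
have sh' : \sum_(k < r) (c - s k) * rp_integral (u k) nu <= rp_integral h' nu.
  rewrite -rp_integral_sum//; apply: le_rp_integral => //.
  apply: le_dense => // k x' ux'.
  suff : c - h' (j x') <= s k by lra.
  apply: lb_le_inf; first by exists (h (j x')), x'.
  by move=> _ [x ux <-]; have := hc _ _ _ ux ux'; lra.
have uE1 : \sum_(k < r) rp_integral (u k) mu = 1.
  rewrite -[RHS](rp_integral_cst mu).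
  under eq_bigr do rewrite -[rp_integral _ _]mul1r.
  rewrite -(rp_integral_sum _ _ (fun=> 1))//; congr (rp_integral _ mu).
  by apply/funext => z; under eq_bigr do rewrite mul1r; exact: u1.
have : c * 1 <= rp_integral h mu + rp_integral h' nu.
  rewrite -uE1 mulr_sumr; apply: le_trans (lerD sh sh').
  rewrite -big_split/=; apply: ler_sum => k _.
  by rewrite uE -mulrDl addrC subrK.
by rewrite /c; lra.
Qed.

(* The points are chosen one at a time, the new deviation vector having
   inner product at most [1/2] with the sum of the previous ones; the squared
   norm of the sum then grows linearly, and [n] does not depend on [u]. *)
Lemma exists_sample (H : seq (Cstar R Z)) mu nu (d : R) : 0 < d ->
  exists n, forall r (u : 'I_r -> Z -> R), Cstar_partition u ->
    (forall k, rp_integral (u k) mu = rp_integral (u k) nu) ->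
    exists x x' : 'I_n.+1 -> X,
      (forall i, exists k, u k (j (x i)) != 0 /\ u k (j (x' i)) != 0) /\
      forall h, h \in H ->
        `|n.+1%:R^-1 * \sum_(i < n.+1) sval h (j (x i)) -
          rp_integral (sval h) mu| < d /\
        `|n.+1%:R^-1 * \sum_(i < n.+1) sval h (j (x' i)) -
          rp_integral (sval h) nu| < d.
Proof.
move=> d0.
pose G (p : X * X) (h : Cstar R Z) := sval h (j p.1) - rp_integral (sval h) mu.
pose G' (p : X * X) (h : Cstar R Z) := sval h (j p.2) - rp_integral (sval h) nu.
(* [C] bounds the squared length of every deviation vector, whose entries are all [G p h] and
   [G' p h]. *)
have [C C0 GC] : exists2 C, 0 <= C & forall p,
    \sum_(h <- H) (G p h ^+ 2 + G' p h ^+ 2) <= C.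
  elim: H => [|h H [C C0 IH]].
    by exists 0 => // p; rewrite big_nil.
  have /bounded_funP[M hM] := (svalP h).2.
  pose B := `|rp_integral (sval h) mu| + `|rp_integral (sval h) nu| + `|M|.
  exists (B ^+ 2 + B ^+ 2 + C); first by rewrite !addr_ge0// sqr_ge0.
  move=> p; rewrite big_cons; apply: lerD => //.
  have GB q : `|q| <= B -> q ^+ 2 <= B ^+ 2.
    move=> qB; rewrite -real_normK ?num_real//.
    by rewrite lerXn2r// ?nnegrE// (le_trans _ qB).
  have hM' z : `|sval h z| <= `|M| := le_trans (hM z) (ler_norm M).
  apply: lerD; apply: GB; apply: le_trans (ler_normB _ _) _; rewrite /B.
    by have := hM' (j p.1); have := normr_ge0 (rp_integral (sval h) nu); lra.
  by have := hM' (j p.2); have := normr_ge0 (rp_integral (sval h) mu); lra.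
(* This gives [C + 1 < n.+1 * d ^+ 2], so a sum of squared length at most [n.+1 * (C + 1)], divided
   by [n.+1], has all entries below [d] in absolute value. *)
pose n := Num.truncn ((C + 1) / d ^+ 2); exists n => r u pu uE.
pose S (s : seq (X * X)) h := \sum_(p <- s) G p h.
pose S' (s : seq (X * X)) h := \sum_(p <- s) G' p h.
have greedy m : exists2 s : seq (X * X), size s = m /\ (forall p, p \in s ->
      exists k, u k (j p.1) != 0 /\ u k (j p.2) != 0) &
    \sum_(h <- H) (S s h ^+ 2 + S' s h ^+ 2) <= m%:R * (C + 1).
  elim: m => [|m [s [ss su] sC]].
    exists [::] => //; rewrite mul0r big1// => h _.
    by rewrite /S /S' !big_nil expr0n addr0.
  have chH (h : Cstar R Z) : continuous (sval h) := (svalP h).1.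
  have bhH (h : Cstar R Z) : bounded_fun (sval h) := (svalP h).2.
  have cg (a : Cstar R Z -> R) :
      continuous (fun z => \sum_(h <- H) a h * sval h z).
    by apply: continuous_sumr => h; apply: continuous_mulr => //;
      exact: cst_continuous.
  have bg (a : Cstar R Z -> R) :
      bounded_fun (fun z => \sum_(h <- H) a h * sval h z).
    by apply: bounded_fun_sum => h; exact: bounded_funZ.
  have half0 : 0 < 2^-1 :> R by rewrite invr_gt0.
  (* With the sums of earlier deviations as coefficients of the two test functions, value minus
     integral is the inner product with the new deviation. The squared length then grows by at most
     [2 * 2^-1 + C]. *)
  have [k [x [x' [ux ux']]]] :=
    exists_below_integral pu uE (cg (S s)) (bg (S s)) (cg (S' s)) (bg (S' s))
      half0.
  rewrite !rp_integral_sum// => le12.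
  have inner :
      \sum_(h <- H) (S s h * G (x, x') h + S' s h * G' (x, x') h) <= 2^-1.
    rewrite (eq_bigr (fun h => (S s h * sval h (j x) + S' s h * sval h (j x')) -
      (S s h * rp_integral (sval h) mu + S' s h * rp_integral (sval h) nu))).
      by rewrite sumrB !big_split/=; lra.
    by move=> h _; rewrite /G /G' /=; ring.
  exists ((x, x') :: s).
    split; first by rewrite /= ss.
    by move=> p; rewrite inE => /predU1P[->|/su//]; exists k.
  rewrite (eq_bigr (fun h => (S s h ^+ 2 + S' s h ^+ 2) +
     2 * (S s h * G (x, x') h + S' s h * G' (x, x') h) +
     (G (x, x') h ^+ 2 + G' (x, x') h ^+ 2))).
    rewrite 2!big_split/= -mulr_sumr -natr1.
    by have := GC (x, x'); lra.
  by move=> h _; rewrite /S /S' !big_cons; ring.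
have [s [ss su] sC] := greedy n.+1.
have st : size s == n.+1 by rewrite ss.
pose T := Tuple st.
have sumT (F : X * X -> R) : \sum_(i < n.+1) F (tnth T i) = \sum_(p <- s) F p.
  exact: (esym (big_tuple _ _ T xpredT F)).
exists (fun i => (tnth T i).1), (fun i => (tnth T i).2); split.
  by move=> i; apply: su; exact: mem_tnth.
have n0 : 0 < n.+1%:R :> R by rewrite ltr0n.
have small a : a ^+ 2 <= n.+1%:R * (C + 1) -> `|n.+1%:R^-1 * a| < d.
  move=> aC; rewrite normrM gtr0_norm ?invr_gt0// mulrC ltr_pdivrMr//.
  rewrite -(ltr_pXn2r (_ : 0 < 2)%N) ?nnegrE ?normr_ge0// ?mulr_ge0 ?ltW//.
  rewrite real_normK ?num_real//; apply: le_lt_trans aC _.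
  rewrite exprMn [ltRHS]mulrC expr2 -mulrA ltr_pM2l//.
  by rewrite -ltr_pdivrMr ?exprn_gt0//; exact: truncnS_gt.
move=> h hH.
have sq_le : S s h ^+ 2 + S' s h ^+ 2 <= n.+1%:R * (C + 1).
  apply: le_trans sC; rewrite (big_rem h hH)/= lerDl.
  by apply: sumr_ge0 => h' _; rewrite addr_ge0// sqr_ge0.
have dev (F : X * X -> R) c :
    n.+1%:R^-1 * \sum_(i < n.+1) F (tnth T i) - c =
    n.+1%:R^-1 * \sum_(p <- s) (F p - c).
  rewrite -(sumT (fun p => F p - c)) sumrB sumr_const card_ord mulrBr.
  by rewrite -[X in _ - _ * X]mulr_natl mulKf ?gt_eqF.
split.
  rewrite (dev (fun p => sval h (j p.1))); apply: small.
  by have := sqr_ge0 (S' s h); rewrite -/(S s h); lra.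
rewrite (dev (fun p => sval h (j p.2))); apply: small.
by have := sqr_ge0 (S s h); rewrite -/(S' s h); lra.
Qed.

End sampling.

(** * Extension of functions *)

Lemma continuous_of_nbhs (R : realType) (X : topologicalType) (g : X -> R) :
  (forall (x : X) (c : R), 0 < c ->
    exists2 U, nbhs x U & forall w, U w -> `|g w - g x| <= c) -> continuous g.
Proof.
move=> gU x; apply/cvgrPdist_le => c c0; have [U xU Uc] := gU x c c0.
by apply: filterS xU => w Uw; rewrite distrC; exact: Uc.
Qed.

(** The map [j] abstracts the embedding into the Stone-Cech compactification through three
    properties: continuity, dense image, and extension of bounded continuous functions. *)
Section extension.
Context (R : realType) (X Z : topologicalType) (j : X -> Z).
Hypothesis cozX : cozero_base R X.
Hypothesis pcXn : forall n, pseudocompact R {ptws 'I_n -> X}.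
Hypothesis cj : continuous j.
Hypothesis dj : closure (range j) = setT.
Hypothesis extj : forall f : X -> R, continuous f -> bounded_fun f ->
  exists g : Z -> R, [/\ continuous g, bounded_fun g & forall x, g (j x) = f x].

Lemma uniform_probability_continuous n :
  continuous (fun x : {ptws 'I_n.+1 -> X} => uniform_probability R (j \o x)).
Proof.
apply: continuous_to_radon_probability => h.
have [ch bh] := svalP h.
have -> : (fun x : {ptws 'I_n.+1 -> X} =>
      rp_integral (sval h) (uniform_probability R (j \o x))) =
    (fun x => n.+1%:R^-1 * \sum_(i < n.+1) sval h (j (x i))).
  by apply/funext => x; rewrite rp_integral_uniform.
apply: continuous_mulr; first exact: cst_continuous.
apply: continuous_sumr => i; apply: continuous_compT ch.
by apply: continuous_compT cj; exact: continuous_ptws_proj.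
Qed.

(** The partition of [X] extends to [Z] and, by density, stays nonnegative with sum 1. Its size is
    bundled with it so that choice can select one partition per pair of sample size and
    precision. *)
Lemma power_Cstar_partition n (f : {ptws 'I_n.+1 -> X} -> R) (e : R) :
  continuous f -> 0 < e ->
  exists p : {r & 'I_r -> Cstar R Z},
    Cstar_partition (fun k => sval (projT2 p k)) /\
    forall x x' : 'I_n.+1 -> X, (forall i, exists k,
      sval (projT2 p k) (j (x i)) != 0 /\ sval (projT2 p k) (j (x' i)) != 0) ->
    `|f x - f x'| <= e.
Proof.
move=> cf e0.
have [r [u [[cu u0 u1] uf]]] := power_partition cozX pcXn cf e0.
have u_le1 k x : u k x <= 1.
  by rewrite -(u1 x) (bigD1 k)//= lerDl sumr_ge0.
have /choice[U HU] : forall k, exists h : Cstar R Z,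
    forall x, sval h (j x) = u k x.
  move=> k; have [|g [cg bg gu]] := extj (cu k).
    by apply/bounded_funP; exists 1 => x; rewrite ger0_norm.
  by exists (exist _ g (conj cg bg)).
have cU k : continuous (sval (U k)) by have [] := svalP (U k).
exists (existT _ r U); split; last first.
  move=> x x' xx'; apply: uf => i; have [k] := xx' i.
  by rewrite /= !HU; exists k.
split; last by move=> k; have [] := svalP (U k).
split=> [//|k|z].
  by apply: (dense_ge0 dj) => // x; rewrite HU.
apply/eqP; rewrite eq_le; apply/andP; split; rewrite -subr_ge0.
  apply: (dense_ge0 dj (g := fun z => 1 - \sum_(k < r) sval (U k) z)).
    by apply: continuous_subr; [exact: cst_continuous|exact: continuous_sumr].
  by move=> x; under eq_bigr do rewrite HU; rewrite u1 subrr.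
apply: (dense_ge0 dj (g := fun z => \sum_(k < r) sval (U k) z - 1)).
  by apply: continuous_subr; [exact: continuous_sumr|exact: cst_continuous].
by move=> x; under eq_bigr do rewrite HU; rewrite u1 subrr.
Qed.

Variable Y : set (radon_probability R Z).
Hypothesis pcY : pseudocompact R Y.
Hypothesis uY : forall n (x : 'I_n.+1 -> X), Y (uniform_probability R (j \o x)).

Let toY n (x : 'I_n.+1 -> X) : Y :=
  exist (fun mu => mu \in Y) _ (mem_set (uY x)).

Lemma eq_on_separated_fibres (f : Y -> R) : continuous f ->
  exists e : nat -> Cstar R Z, forall y y' : Y,
    (forall i, rp_integral (sval (e i)) (\val y) =
               rp_integral (sval (e i)) (\val y')) -> f y = f y'.
Proof.
move=> cf.
have cfu n : continuous (fun x : {ptws 'I_n.+1 -> X} => f (toY x)).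
  apply: continuous_compT cf; apply: continuous_to_set_type.
  exact: uniform_probability_continuous.
have m0 (m : nat) : 0 < m.+1%:R^-1 :> R by rewrite invr_gt0.
have /choice[fam famP] := fun nm : nat * nat =>
  power_Cstar_partition (cfu nm.1) (m0 nm.2).
have cst0 : continuous (fun _ : Z => 0 : R) /\ bounded_fun (fun _ : Z => 0 : R).
  by split; [exact: cst_continuous|exact: bounded_fun_cst].
(* The code [i] holds sample size, precision and position in the partition; all other codes give the
   zero function. *)
pose e i : Cstar R Z := if unpickle i is Some (n, m, k) then
  if insub k is Some k' then projT2 (fam (n, m)) k' else exist _ _ cst0
  else exist _ _ cst0.
exists e => y y' yy'; apply/eqP; rewrite -subr_eq0 -normr_eq0.
rewrite eq_le normr_ge0 andbT leNgt; apply/negP => fyy'.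
set a : R := `|f y - f y'| in fyy'.
have a30 : 0 < a / 3 by lra.
have near_f (z : Y) : nbhs z [set z' | `|f z - f z'| < a / 3].
  by have /cvgrPdist_lt := cf z; exact.
have [V1 V1y V1f] := nbhs_set_type (near_f y).
have [V2 V2y V2f] := nbhs_set_type (near_f y').
have [H1 [d1 d10 H1V]] := nbhs_radon_probability V1y.
have [H2 [d2 d20 H2V]] := nbhs_radon_probability V2y.
have d0 : 0 < Num.min d1 d2 by rewrite lt_min d10.
(* [n] comes from the neighbourhoods of [y] and [y'] alone, before any partition is named; the
   partition for this [n] and the precision [m] chosen below then already belongs to [e]. *)
have [n nP] := exists_sample dj (H1 ++ H2) (\val y) (\val y') d0.
pose m := Num.truncn (a / 3)^-1.
have ma : m.+1%:R^-1 < a / 3.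
  by rewrite invf_plt ?posrE//; exact: truncnS_gt.
have [part partf] := famP (n, m).
have [k|x [x' [xx' dev]]] := nP _ _ part.
  have := yy' (pickle (n, m, nat_of_ord k)).
  by rewrite /e pickleK /= valK.
have hx : `|f y - f (toY x)| < a / 3.
  apply: V1f; apply: H1V => h hH.
  have [ch bh] := svalP h; rewrite rp_integral_uniform//.
  have := dev h; rewrite mem_cat hH => /(_ isT)[+ _].
  by rewrite lt_min => /andP[].
have hx' : `|f y' - f (toY x')| < a / 3.
  apply: V2f; apply: H2V => h hH.
  have [ch bh] := svalP h; rewrite rp_integral_uniform//.
  have := dev h; rewrite mem_cat hH orbT => /(_ isT)[_].
  by rewrite lt_min => /andP[].
have hxx' : `|f (toY x) - f (toY x')| < a / 3.
  exact: le_lt_trans (partf x x' xx') ma.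
have := ler_distD (f (toY x)) (f y) (f y').
have := ler_distD (f (toY x')) (f (toY x)) (f y').
rewrite (distrC (f (toY x')) (f y')) -/a => t1 t2.
by lra.
Qed.

(** Sampling with both measures equal to [mu] and the one-element partition. *)
Lemma uniform_probability_dense mu (H : seq (Cstar R Z)) (d : R) :
  0 < d -> exists y : Y, forall h : Cstar R Z, h \in H ->
    `|rp_integral (sval h) (\val y) - rp_integral (sval h) mu| < d.
Proof.
move=> d0; have [n nP] := exists_sample dj H mu mu d0.
have pu : Cstar_partition (fun (_ : 'I_1) (_ : Z) => 1 : R).
  by split; [exact: partition_of_unity_cst1|move=> _; exact: bounded_fun_cst].
have [//|x [x' [_ dev]]] := nP _ _ pu.
exists (toY x) => h hH; have [ch bh] := svalP h.
by rewrite rp_integral_uniform//; have [] := dev h hH.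
Qed.

Lemma pseudocompact_Cstar_embedded : Cstar_embedded R Y.
Proof.
move=> [f [cf bf]] /=.
have [e eP] := eq_on_separated_fibres cf.
pose I i mu := rp_integral (sval (e i)) mu.
pose D N mu nu := \sum_(i < N) `|I i nu - I i mu|.
have cI i : continuous (I i) := @rp_integral_continuous R Z (e i).
have cD N mu : continuous (D N mu).
  apply: continuous_sumr => i; apply: continuous_normr.
  by apply: continuous_subr; [exact: cI|exact: cst_continuous].
have cDY N mu : continuous (fun y : Y => D N mu (\val y)).
  exact: continuous_compT (@continuous_val _ Y) (cD N mu).
pose pos (a : R) := a + `|a|.
have posN0 a : pos a != 0 -> 0 < a.
  by rewrite /pos; case: ler0P => // h; rewrite subrr eqxx.
have pos_neq0 a : 0 < a -> pos a != 0.
  by move=> a0; rewrite /pos gtr0_norm// gt_eqF// addr_gt0.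
have cpos (g : Y -> R) : continuous g -> continuous (fun y => pos (g y)).
  by move=> cg; apply: continuous_addr => //; exact: continuous_normr.
(* Each [phi N] lives where the first [N] integrals are within [1 / N.+1] of those of [mu], so a
   cluster point agrees with [mu] on every [e i]. *)
have cluster_fibre mu (phi : nat -> Y -> R) :
    (forall N, continuous (phi N)) -> (forall N, exists y, phi N y != 0) ->
    (forall N y, phi N y != 0 -> D N mu (\val y) < N.+1%:R^-1) ->
    exists2 y : Y, (forall i, I i (\val y) = I i mu) &
      forall U : set Y, nbhs y U -> exists N w, U w /\ phi N w != 0.
  move=> cphi phi0 phiD; have [y clus] := pseudocompact_cluster pcY cphi phi0.
  exists y; last first.
    by move=> U yU; have [N [_ [w ?]]] := clus U yU 0%N; exists N, w.
  move=> i; apply/eqP; rewrite -subr_eq0 -normr_eq0 eq_le normr_ge0 andbT leNgt.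
  apply/negP; set a : R := `|_| => a0.
  have cIY : continuous (fun y : Y => I i (\val y)).
    exact: continuous_compT (@continuous_val _ Y) (cI i).
  have yU : nbhs y [set w : Y | `|I i (\val y) - I i (\val w)| < a / 2].
    have a20 : 0 < a / 2 by lra.
    by have /cvgrPdist_lt := cIY y; exact.
  pose m := Num.truncn (a / 2)^-1.
  (* [N >= i.+1] makes the term [i] occur in [D N], and [N >= m] puts [1 / N.+1] below [a / 2]. *)
  have [N [mN [w [/= wU /phiD wD]]]] := clus _ yU (maxn i.+1 m).
  move: mN; rewrite geq_max => /andP[iN mN].
  have Na : N.+1%:R^-1 < a / 2.
    rewrite invf_plt ?posrE//; last by lra.
    by apply: lt_le_trans (truncnS_gt _) _; rewrite ler_nat.
  have iD : `|I i (\val w) - I i mu| <= D N mu (\val w).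
    by rewrite /D (bigD1 (Ordinal iN))//= lerDl sumr_ge0.
  have := lt_trans wD Na.
  by have := ler_distD (I i (\val w)) (I i (\val y)) (I i mu); rewrite -/a; lra.
have D_dense N mu : exists y : Y, D N mu (\val y) < N.+1%:R^-1.
  (* [N] terms of this size sum to less than [1 / N.+1]. *)
  have d0 : 0 < (N.+1%:R * N.+1%:R)^-1 :> R by rewrite invr_gt0 mulr_gt0.
  have [y yP] := uniform_probability_dense mu [seq e i | i <- iota 0 N] d0.
  exists y; apply: (@le_lt_trans _ _ (\sum_(i < N) (N.+1%:R * N.+1%:R)^-1)).
    apply: ler_sum => i _; apply/ltW/yP/map_f.
    by rewrite mem_iota add0n/= ltn_ord.
  rewrite sumr_const card_ord -[ltLHS]mulr_natl invfM mulrA.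
  by rewrite gtr_pMl ?invr_gt0// ltr_pdivrMr// mul1r ltr_nat.
have /choice[y0 y0P] : forall mu, exists y : Y, forall i, I i (\val y) = I i mu.
  move=> mu.
  have [||N y /posN0|y yP _] :=
    @cluster_fibre mu (fun N y => pos (N.+1%:R^-1 - D N mu (\val y))).
  - move=> N; apply: cpos; apply: continuous_subr; last exact: cDY.
    exact: cst_continuous.
  - move=> N; have [y yD] := D_dense N mu; exists y; apply: pos_neq0.
    by rewrite subr_gt0.
  - by rewrite subr_gt0.
  - by exists y.
(* Otherwise the sets where [D N mu] is small but [f] is more than [c] away from [f (y0 mu)] cluster
   at a point [y] of the fibre of [mu]. There [f y = f (y0 mu)] by [eP], against continuity of
   [f]. *)
have y0f mu (c : R) : 0 < c -> exists N, forall y : Y,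
    D N mu (\val y) < N.+1%:R^-1 -> `|f y - f (y0 mu)| <= c.
  move=> c0; apply: contrapT => nN.
  pose phi N y := pos (N.+1%:R^-1 - D N mu (\val y)) *
    pos (`|f y - f (y0 mu)| - c).
  have [||N y|y yP yU] := @cluster_fibre mu phi.
  - move=> N; apply: continuous_mulr.
      apply: cpos; apply: continuous_subr; last exact: cDY.
      exact: cst_continuous.
    apply: cpos; apply: continuous_subr; last exact: cst_continuous.
    apply: continuous_normr; apply: continuous_subr => //.
    exact: cst_continuous.
  - move=> N; apply: contrapT => ny; apply: nN; exists N => y yD.
    rewrite leNgt; apply/negP => fy; apply: ny; exists y.
    by rewrite mulf_neq0// pos_neq0// subr_gt0.
  - by rewrite mulf_eq0 negb_or => /andP[/posN0 + _]; rewrite subr_gt0.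
  - have fyE : f y = f (y0 mu) by apply: eP => i; rewrite -!/(I _ _) yP y0P.
    have /yU[N [w [/= yw]]] : nbhs y [set w | `|f y - f w| < c].
      by have /cvgrPdist_lt := cf y; exact.
    rewrite mulf_eq0 negb_or => /andP[_ /posN0].
    by rewrite -fyE distrC; lra.
exists (fun mu => f (y0 mu)); last first.
  by move=> y; apply: eP => i; rewrite -!/(I _ _) y0P.
apply: continuous_of_nbhs => mu c c0; have [N NP] := y0f mu c c0.
exists [set nu | D N mu nu < N.+1%:R^-1].
  have D0 : D N mu mu < N.+1%:R^-1.
    by rewrite /D big1 ?invr_gt0// => i _; rewrite subrr normr0.
  exact: cD (lt_nbhsl D0).
(* [y0 nu] integrates every [e i] as [nu] does, so [D N mu] takes the same value at both. *)
by move=> nu nuD; apply: NP; rewrite /D; under eq_bigr do rewrite y0P.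
Qed.

End extension.

(** * Properties of the Stone-Cech compactification *)

Section stone_cech_theory.
Context (R : realType) (X : topologicalType).
Let j : X -> stone_cech R X := to_stone_cech R.

Lemma to_stone_cech_continuous : continuous j.
Proof.
apply: (@continuous_to_set_type X {ptws (Cstar R X) -> R}
  (closure (range (@Cstar_eval R X))) j).
apply: (@continuous_to_ptws (Cstar R X) X R) => f.
exact: (svalP f).1.
Qed.

Lemma to_stone_cech_dense : closure (range j) = setT.
Proof.
apply/seteqP; split=> // z _ U /nbhs_set_type[V zV VU].
have [_ [[x _ <-] Vx]] := set_mem (svalP z) V zV.
by exists (j x); split; [exists x|exact: VU].
Qed.

(** The extension is the coordinate projection indexed by [f] itself; its bound passes from the
    image of [X] by density. *)
Lemma stone_cech_extension (f : X -> R) : continuous f -> bounded_fun f ->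
  exists g : stone_cech R X -> R,
    [/\ continuous g, bounded_fun g & forall x, g (j x) = f x].
Proof.
move=> cf bf; pose F : Cstar R X := exist _ f (conj cf bf).
pose g (z : stone_cech R X) : R := (\val z : {ptws (Cstar R X) -> R}) F.
have cg : continuous g.
  exact: (@continuous_compT (stone_cech R X) {ptws (Cstar R X) -> R} R
    (fun z => \val z) (fun h => h F)
    (@continuous_val _ (closure (range (@Cstar_eval R X))))
    (@continuous_ptws_proj (Cstar R X) R F)).
exists g; split=> //.
have /bounded_funP[M fM] := bf; apply/bounded_funP; exists M => z.
rewrite -subr_ge0.
apply: (dense_ge0 to_stone_cech_dense (g := fun z => M - `|g z|)).
  by apply: continuous_subr; [exact: cst_continuous|exact: continuous_normr].
by move=> x; rewrite subr_ge0; exact: fM.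
Qed.

End stone_cech_theory.

Theorem theorem1p7 (R : realType) (X : topologicalType)
    (hX : tychonoff_space X)
    (hXn : forall n : nat, pseudocompact R {ptws 'I_n -> X})
    (Y : set (radon_probability R (stone_cech R X)))
    (hY : pseudocompact R Y)
    (hPfY : finite_probability R (range (to_stone_cech R (X := X))) `<=` Y) :
  Cstar_embedded R Y.
Proof.
apply: (pseudocompact_Cstar_embedded
  (completely_regular_cozero_base R hX.1) hXn
  (@to_stone_cech_continuous R X) (@to_stone_cech_dense R X)
  (@stone_cech_extension R X) hY) => n x.
by apply: hPfY; apply: finite_uniform_probability => i; exists (x i).
Qed.
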